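(* Let $K$ be a graph. If $K$ has property ( * ), then every subgraph of $K$ has property ( * ). Furthermore, $K$ has property ( * ) if and only if every (connected) component of $K$ has property ( * ).
   Context: All graphs are finite, undirected, and simple. An anticlique is a set of pairwise nonadjacent vertices. A coloring of a graph $G$ is a partition $\mathfrak{C}$ of $V(G)$ into anticliques (nonempty, called color classes). A transversal of $\mathfrak{C}$ is a set $T$ containing exactly one element of each member of $\mathfrak{C}$ and nothing else. A Kempe chain is a connected component of $G[A\cup B]$ for some $A\neq B$ from $\mathfrak{C}$. The routing graph $H(G,\mathfrak{C},T)$ is the graph on vertex set $T$ in which two distinct $s,t\in T$ are adjacent if and only if they belong to the same Kempe chain in $G$ (equivalently, there is an $s$,$t$-path in $G[A\cup B]$ where $A,B\in\mathfrak{C}$ are the classes containing $s,t$). For a graph $H$ with $V(H)\subseteq V(G)$, a rooted $H$-certificate in $G$ is a family $(V_t)_{t\in V(H)}$ of pairwise disjoint subsets of $V(G)$ (bags) such that $t\in V_t$ and $G[V_t]$ is connected for all $t\in V(H)$, and for every $st\in E(H)$ there is an edge of $G$ connecting $V_s$ and $V_t$. A graph $K$ has property ( * ) if for every graph $G$, every coloring $\mathfrak{C}$ of $G$ with $|\mathfrak{C}|=|V(K)|$, every transversal $T$ of $\mathfrak{C}$, and every spanning subgraph $H$ of $H(G,\mathfrak{C},T)$ isomorphic to $K$, there exists a rooted $H$-certificate in $G$. *)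

(* Defs.v *)
From mathcomp Require Import all_boot.

Set Implicit Arguments.
Unset Strict Implicit.
Unset Printing Implicit Defensive.

Record sgraph (V : finType) := SGraph {
  adj : rel V;
  adj_sym : symmetric adj;
  adj_irr : irreflexive adj }.

Section Graphs.
Variable V : finType.
Implicit Types (G H : sgraph V) (A S : {set V}).

Definition isomorphic (W : finType) G (K : sgraph W) : Prop :=
  exists2 f : V -> W, bijective f & {mono f : x y / adj G x y >-> adj K x y}.

Definition spanning_subgraph H G : Prop := subrel (adj H) (adj G).

(* A graph whose vertex set is the subset [S] of [V] lives on the subtype
   [{x : V | x \in S}]. *)
Definition subgraph S (H : sgraph {x : V | x \in S}) G : Prop :=
  forall x y, adj H x y -> adj G (val x) (val y).

Definition induced_adj G S : rel {x : V | x \in S} :=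
  fun x y => adj G (val x) (val y).

Lemma induced_adj_sym G S : symmetric (@induced_adj G S).
Proof. by move=> x y; apply: adj_sym. Qed.

Lemma induced_adj_irr G S : irreflexive (@induced_adj G S).
Proof. by move=> x; apply: adj_irr. Qed.

Definition induced G S : sgraph {x : V | x \in S} :=
  SGraph (@induced_adj_sym G S) (@induced_adj_irr G S).

Definition components G : {set {set V}} :=
  equivalence_partition (connect (adj G)) [set: V].

Definition connected G : Prop := forall x y : V, connect (adj G) x y.

Definition anticlique G A : bool :=
  [forall x in A, forall y in A, ~~ adj G x y].

Definition coloring G (P : {set {set V}}) : bool :=
  partition P [set: V] && [forall A in P, anticlique G A].

End Graphs.

Section Routing.
Variables (V : finType) (G : sgraph V) (P : {set {set V}}).

Definition kempe_chain (D : {set V}) : bool :=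
  [exists A in P, exists B in P,
     (A != B) && [exists X in components (induced G (A :|: B)),
                    D == [set val x | x in X]]].

Variable T : {set V}.

Definition routing_adj : rel {x : V | x \in T} := fun s t =>
  (s != t) &&
  [exists D : {set V}, [&& kempe_chain D, val s \in D & val t \in D]].

Lemma routing_adj_sym : symmetric routing_adj.
Proof.
move=> s t; rewrite /routing_adj eq_sym; congr andb.
by apply: eq_existsb => D; rewrite [(val s \in D) && _]andbC.
Qed.

Lemma routing_adj_irr : irreflexive routing_adj.
Proof. by move=> s; rewrite /routing_adj eqxx. Qed.

Definition routing_graph : sgraph {x : V | x \in T} :=
  SGraph routing_adj_sym routing_adj_irr.

End Routing.

Definition rooted_certificate (V : finType) (G : sgraph V) (S : {set V})
    (H : sgraph {x : V | x \in S}) (bag : {x : V | x \in S} -> {set V}) : Prop :=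
  [/\ forall s t, s != t -> [disjoint bag s & bag t],
      forall t, val t \in bag t,
      forall t, connected (induced G (bag t))
    & forall s t, adj H s t ->
        exists x y, [/\ x \in bag s, y \in bag t & adj G x y]].

(* Property ( * ). [is_transversal T P [set: U]] says that [P] partitions [U]
   and that [T] meets every member of [P] in exactly one element. *)
Definition property_star (V : finType) (K : sgraph V) : Prop :=
  forall (U : finType) (G : sgraph U) (P : {set {set U}}) (T : {set U}),
    coloring G P -> #|P| = #|V| -> is_transversal T P [set: U] ->
  forall H : sgraph {x : U | x \in T},
    spanning_subgraph H (routing_graph G P T) -> isomorphic H K ->
  exists bag, rooted_certificate G H bag.

(* Main.v *)
Require Import Defs.
From mathcomp Require Import all_boot.

(** A coloring with a transversal indexed by the vertices of [K] is the same
thing as a labelling [c : U -> V] of the vertices of [G] by the vertices of [K],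
injective along edges, together with a section [r] of [c] that picks the root of
each class.  A spanning subgraph of the routing graph isomorphic to [K] then says
that, for each edge [vw] of [K], the roots [r v] and [r w] are joined inside
the classes of [v] and [w].  In this form ([property_starE]) nothing lives on a
transversal any more and both halves of the theorem become constructions on [G].

Heredity ([labelled_star_hom]).  Let [L] be a subgraph of [K] and let [G] carry a
labelling by [L].  Add one isolated vertex per vertex of [K] to serve as root of the
labels outside [L], and join directly every two roots whose labels are adjacent
in [K] but not in [L].  Now all edges of [K] are routed, so there is a
[K]-certificate in the enlarged graph.  Each of its bags contains exactly one
root, so no added edge lies inside a bag, and an added edge can
connect only the two bags of an edge of [K] that is missing from [L].  Hence
the bags of the vertices of [L] form an [L]-certificate in [G] itself.

Components ([labelled_star_components]).  A Kempe chain through the roots of an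
edge of [K] uses only labels of one component [X], so it survives in the
subgraph of [G] induced by the labels in [X]; the property for [X] gives bags
there ([partial_certificate]).  Bags for different components are disjoint because
their labels are, and [K] has no edge between components, so the bags together
form a certificate. *)

Set Implicit Arguments.
Unset Strict Implicit.
Unset Printing Implicit Defensive.

(** * Connectivity inside a vertex subset *)

Lemma connect_homo (A B : finType) (e : rel A) (e' : rel B) (h : A -> B) :
    (forall x y, e x y -> connect e' (h x) (h y)) ->
  forall x y, connect e x y -> connect e' (h x) (h y).
Proof.
move=> hom x y /connectP[p + ->]; elim: p x => [|z p IHp] x /= => [|/andP[exz]].
  by rewrite connect0.
by move/IHp; apply: connect_trans; apply: hom.
Qed.

Section Joined.
Variables (U : finType) (G : sgraph U).
Implicit Types S : {set U}.

(** Connectivity in [induced G S], but as a relation on the whole vertex set, so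
    that different subsets can be compared without casts between subtypes. *)
Definition joined S : rel U :=
  connect [rel x y | [&& x \in S, y \in S & adj G x y]].

Lemma joined1 S x y : x \in S -> y \in S -> adj G x y -> joined S x y.
Proof. by move=> Sx Sy Gxy; apply: connect1; rewrite /= Sx Sy. Qed.

Lemma joined_sub S S' x y : S \subset S' -> joined S x y -> joined S' x y.
Proof.
move/subsetP=> sSS'; apply: connect_sub => u v /= /and3P[Su Sv].
by apply: joined1; apply: sSS'.
Qed.

Lemma connect_induced S (x y : {x : U | x \in S}) :
  connect (adj (induced G S)) x y = joined S (val x) (val y).
Proof.
apply/idP/idP; last first.
  (* [insubd x] is a retraction onto the subtype that maps edges within [S]
     to edges. *)
  rewrite -{2}(valKd x x) -{2}(valKd x y); apply: connect_homo => u v.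
  by case/and3P=> Su Sv Guv; apply: connect1; rewrite /= /induced_adj !insubdK.
by apply: connect_homo => u v Guv; apply: joined1 => //; apply: valP.
Qed.

Lemma connected_induced S :
  connected (induced G S) <-> {in S &, forall x y, joined S x y}.
Proof.
split=> [conS x y Sx Sy | joinS x y].
  by have := conS (Sub x Sx) (Sub y Sy); rewrite connect_induced !SubK.
by rewrite connect_induced; apply: joinS; apply: valP.
Qed.

End Joined.

Lemma joined_homo (U W : finType) (G : sgraph U) (G' : sgraph W)
    (h : U -> W) (S : {set U}) (S' : {set W}) x y :
    {in S, forall u, h u \in S'} ->
    {in S &, forall u v, adj G u v -> adj G' (h u) (h v)} ->
  joined G S x y -> joined G' S' (h x) (h y).
Proof.
move=> hS hG; apply: connect_homo => u v /= /and3P[Su Sv Guv].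
by apply: joined1; [apply: hS | apply: hS | apply: hG].
Qed.

(** * Components and Kempe chains *)

Lemma connect_adj_equivalence (V : finType) (G : sgraph V) :
  {in [set: V] & &, equivalence_rel (connect (adj G))}.
Proof.
move=> x y z _ _ _; rewrite connect0; split=> // Gxy.
by apply: (same_connect _ Gxy); apply: sym_connect_sym; apply: adj_sym.
Qed.

Lemma mem_component (V : finType) (G : sgraph V) (X : {set V}) x y :
  X \in components G -> x \in X -> (y \in X) = connect (adj G) x y.
Proof.
have eqG := @connect_adj_equivalence V G.
have /and3P[_ tiX _] := equivalence_partitionP eqG.
move=> XG Xx; rewrite -(def_pblock tiX XG Xx).
by rewrite pblock_equivalence_partition ?inE.
Qed.

Lemma component_exists (V : finType) (G : sgraph V) x :
  exists2 X, X \in components G & x \in X.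
Proof.
have /and3P[/eqP covG _ _] := equivalence_partitionP (@connect_adj_equivalence V G).
have xG : x \in cover (components G) by rewrite covG inE.
by exists (pblock (components G) x); [apply: pblock_mem | rewrite mem_pblock].
Qed.

Lemma kempe_chainP (U : finType) (G : sgraph U) (P : {set {set U}}) (s t : U) :
  reflect
    (exists A B, [/\ A \in P, B \in P, A != B, s \in A :|: B &
                 t \in A :|: B /\ joined G (A :|: B) s t])
    [exists D : {set U}, [&& kempe_chain G P D, s \in D & t \in D]].
Proof.
apply: (iffP existsP) => [[D /and3P[]] | [A [B [PA PB AB ABs [ABt Gst]]]]].
  case/existsP=> A /andP[PA /existsP[B /and3P[PB AB /existsP[X]]]].
  case/andP=> XG /eqP-> /imsetP[x Xx ->] /imsetP[y Xy ->].
  exists A, B; split=> //; first exact: valP.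
  split; first exact: valP.
  by rewrite -connect_induced -(mem_component _ XG Xx).
have [X XG Xs] := component_exists (induced G (A :|: B)) (Sub s ABs).
exists [set val x | x in X]; apply/and3P; split.
- apply/existsP; exists A; rewrite PA; apply/existsP; exists B.
  by rewrite PB AB; apply/existsP; exists X; rewrite XG /=.
- by apply/imsetP; exists (Sub s ABs).
apply/imsetP; exists (Sub t ABt) => //.
by rewrite (mem_component _ XG Xs) connect_induced.
Qed.

(** * Property star for labelled graphs *)

Section Labelled.
Variables (V : finType) (K : sgraph V).

Definition certificate (U : finType) (G : sgraph U) (r : V -> U)
    (bag : V -> {set U}) : Prop :=
  [/\ forall v w, v != w -> [disjoint bag v & bag w],
      forall v, r v \in bag v,
      forall v, {in bag v &, forall x y, joined G (bag v) x y}
    & forall v w, adj K v w ->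
        exists x y, [/\ x \in bag v, y \in bag w & adj G x y]].

(** Distinctness of labels along edges makes the fibres of [c] a proper coloring,
    [cancel r c] makes the image of [r] a transversal, and the last clause places
    [K] inside the routing graph. *)
Definition routed (U : finType) (G : sgraph U) (c : U -> V) (r : V -> U) : Prop :=
  [/\ forall x y, adj G x y -> c x != c y,
      cancel r c
    & forall v w, adj K v w -> joined G (c @^-1: [set v; w]) (r v) (r w)].

Definition labelled_star : Prop :=
  forall (U : finType) (G : sgraph U) (c : U -> V) (r : V -> U),
    routed G c r -> exists bag, certificate G r bag.

(** The color classes are the fibres of [c], all nonempty because [r] is a
    section; [H] is [K] transported along [r] to the set of roots. *)
Lemma property_star_labelled : property_star K -> labelled_star.
Proof.
move=> starK U G c r [Gc rK routeK].
pose fib v := c @^-1: [set v]; pose P := [set fib v | v in V].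
pose T := [set r v | v in V].
have fibE u v : (u \in fib v) = (c u == v) by rewrite !inE.
have fib_inj : injective fib.
  by move=> v w /setP/(_ (r v)); rewrite !fibE !rK eqxx => /esym/eqP.
have partP : partition P setT.
  apply/and3P; split.
  - rewrite eqEsubset subsetT; apply/subsetP=> u _; apply/bigcupP.
    by exists (fib (c u)); rewrite ?fibE ?eqxx //; apply: imset_f.
  - apply/trivIsetP=> _ _ /imsetP[v _ ->] /imsetP[w _ ->] fvw.
    apply/pred0P=> u /=; rewrite !fibE; apply: contraNF fvw.
    by case/andP=> /eqP-> /eqP->.
  apply/imsetP=> -[v _ /setP/(_ (r v))]; by rewrite fibE rK eqxx inE.
have colP : coloring G P.
  rewrite /coloring partP; apply/forall_inP=> _ /imsetP[v _ ->].
  apply/forall_inP=> x; rewrite fibE => /eqP cx.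
  apply/forall_inP=> y; rewrite fibE => /eqP cy.
  by apply/negP=> /Gc; rewrite cx cy eqxx.
have cardP : #|P| = #|V| by rewrite card_imset.
have trT : is_transversal T P setT.
  rewrite /is_transversal partP subsetT; apply/forall_inP=> _ /imsetP[v _ ->].
  apply/cards1P; exists (r v); apply/setP=> u; rewrite in_setI fibE inE.
  apply/andP/eqP=> [[/imsetP[w _ ->]] | ->]; last by rewrite rK imset_f.
  by rewrite rK => /eqP->.
have Tr v : r v \in T by apply: imset_f.
have TrK (s : {x | x \in T}) : r (c (val s)) = val s.
  by case/imsetP: (valP s) => v _ ->; rewrite rK.
pose eH : rel {x | x \in T} := fun s t => adj K (c (val s)) (c (val t)).
have symH : symmetric eH by move=> s t; apply: adj_sym.
have irrH : irreflexive eH by move=> s; apply: adj_irr.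
pose H := SGraph symH irrH.
have HG : spanning_subgraph H (routing_graph G P T).
  move=> s t Hst; have cst : c (val s) != c (val t).
    by apply: contraTneq Hst; rewrite /= /eH => ->; rewrite adj_irr.
  apply/andP; split; first by apply: contraNneq cst => ->.
  apply/kempe_chainP; exists (fib (c (val s))), (fib (c (val t))).
  rewrite !imset_f // (inj_eq fib_inj) !inE !eqxx orbT; split=> //; split=> //.
  rewrite -(TrK s) -(TrK t); apply: joined_sub (routeK _ _ Hst).
  by apply/subsetP=> u; rewrite !inE !TrK.
have isoH : isomorphic H K.
  exists (fun s => c (val s)) => //.
  exists (fun v => Sub (r v) (Tr v)) => [s | v]; last by rewrite SubK rK.
  by apply: val_inj; rewrite SubK TrK.
have [bag [disj root conn edge]] := starK U G P T colP cardP trT H HG isoH.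
exists (fun v => bag (Sub (r v) (Tr v))); split.
- move=> v w vw; apply: disj; apply: contraNneq vw => /(congr1 val).
  by rewrite !SubK => /(can_inj rK) ->.
- by move=> v; have := root (Sub (r v) (Tr v)); rewrite SubK.
- by move=> v; apply/connected_induced.
- by move=> v w Kvw; apply: edge; rewrite /= /eH !SubK !rK.
Qed.

(** A vertex gets as label the image under [H] ~ [K] of the unique transversal
    element of its class. *)
Lemma labelled_property_star : labelled_star -> property_star K.
Proof.
move=> starK U G P T /andP[partP /forall_inP Pcol] _ trT H HG [f [g fK gK] fH].
have /and3P[/eqP covP tiP _] := partP.
have Pu u : pblock P u \in P by apply: pblock_mem; rewrite covP inE.
have uP u : u \in pblock P u by rewrite mem_pblock covP inE.
pose rep u : {x | x \in T} :=
  Sub (transversal_repr u T (pblock P u)) (repr_mem_transversal trT u (Pu u)).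
pose c u := f (rep u); pose r v := val (g v).
have repK s : rep (val s) = s.
  by apply: val_inj; rewrite SubK (pblockK trT) //; apply: valP.
have rK : cancel r c by move=> v; rewrite /c repK gK.
have repP u : pblock P (val (rep u)) = pblock P u.
  by rewrite SubK (transversal_reprK trT _ (Pu u)).
have cP u v : (c u == c v) = (pblock P u == pblock P v).
  rewrite (can_eq fK); apply/eqP/eqP=> [uv | Puv]; first by rewrite -(repP u) uv repP.
  by apply/val_inj/(pblock_inj trT); rewrite ?repP //; apply: valP.
have cA A u v : A \in P -> u \in A -> v \in A -> c u = c v.
  by move=> PA Au Av; apply/eqP; rewrite cP !(def_pblock tiP PA).
have Gc x y : adj G x y -> c x != c y.
  move=> Gxy; rewrite cP; apply/negP=> /eqP Pxy.
  have /forall_inP/(_ x (uP x))/forall_inP/(_ y) := Pcol _ (Pu x).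
  by rewrite {1}Pxy uP Gxy => /(_ isT).
have routeK v w : adj K v w -> joined G (c @^-1: [set v; w]) (r v) (r w).
  rewrite -{1}(gK v) -{1}(gK w) fH => Hvw; have /andP[] := HG _ _ Hvw.
  rewrite (can_eq gK) => vw.
  case/kempe_chainP=> A [B [PA PB AB ABv [ABw]]]; apply: joined_sub.
  (* A Kempe chain containing both roots can only come from their two classes. *)
  have one C : C \in P -> r v \in C -> r w \in C -> False.
    by move=> PC Cv Cw; have:= cA _ _ _ PC Cv Cw; rewrite !rK => /eqP/(negP vw).
  have cr C z u : C \in P -> r z \in C -> u \in C -> c u = z.
    by move=> PC Cz Cu; rewrite (cA _ _ _ PC Cu Cz) rK.
  apply/subsetP=> u; rewrite !inE.
  case/setUP: ABv => [Av | Bv]; case/setUP: ABw => [Aw | Bw].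
  - by case: (one A).
  - by case/orP=> [Au|Bu]; [rewrite (cr A v) | rewrite (cr B w)];
      rewrite ?eqxx ?orbT.
  - by case/orP=> [Au|Bu]; [rewrite (cr A w) | rewrite (cr B v)];
      rewrite ?eqxx ?orbT.
  - by case: (one B).
have [bag [disj root conn edge]] := starK U G c r (And3 Gc rK routeK).
exists (fun s => bag (f s)); split.
- by move=> s t st; apply: disj; rewrite (can_eq fK).
- by move=> s; have := root (f s); rewrite /r fK.
- by move=> s; apply/connected_induced.
- by move=> s t Hst; apply: edge; rewrite fH.
Qed.

Lemma property_starE : property_star K <-> labelled_star.
Proof. by split; [apply: property_star_labelled | apply: labelled_property_star]. Qed.

End Labelled.

(** * Passing to subgraphs *)

Section Hereditary.
Variables (V W : finType) (K : sgraph V) (L : sgraph W) (f : W -> V).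
Hypotheses (f_inj : injective f) (fL : forall v w, adj L v w -> adj K (f v) (f w)).
Variables (U : finType) (G : sgraph U) (c : U -> W) (r : W -> U).
Hypothesis routeG : routed L G c r.

(** The enlarged graph has a spare vertex [inr v] for every [v], including the
    [v] in the image of [f]; the latter stay isolated and are never roots. *)
Definition ext_label (a : U + V) : V :=
  match a with inl u => f (c u) | inr v => v end.

Definition ext_root (v : V) : U + V :=
  if [pick w | f w == v] is Some w then inl (r w) else inr v.

Lemma ext_rootE w : ext_root (f w) = inl (r w).
Proof.
by rewrite /ext_root; case: pickP => [w' /eqP/f_inj-> | /(_ w)/eqP].
Qed.

Lemma ext_rootK : cancel ext_root ext_label.
Proof.
case: routeG => _ rK _ v.
by rewrite /ext_root; case: pickP => //= w /eqP <-; rewrite rK.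
Qed.

Definition missing_edge (v v' : V) : bool :=
  adj K v v' &&
  ~~ [exists w, exists w', [&& f w == v, f w' == v' & adj L w w']].

(** [a == ext_root (ext_label a)] says that [a] is a root: shortcuts join roots
    only. *)
Definition shortcut (a b : U + V) : bool :=
  [&& a == ext_root (ext_label a), b == ext_root (ext_label b)
    & missing_edge (ext_label a) (ext_label b)].

Definition ext_adj (a b : U + V) : bool :=
  (if (a, b) is (inl x, inl y) then adj G x y else false) || shortcut a b.

Lemma ext_label_adj a b : ext_adj a b -> ext_label a != ext_label b.
Proof.
case: routeG => Gc _ _; case/orP=> [|/and3P[_ _ /andP[Kab _]]].
  by case: a b => [x|?] [y|?] //= /Gc; rewrite (inj_eq f_inj).
by apply: contraTneq Kab => ->; rewrite adj_irr.
Qed.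

Lemma ext_adj_irr : irreflexive ext_adj.
Proof. by move=> a; apply/negP=> /ext_label_adj; rewrite eqxx. Qed.

Lemma ext_adj_sym : symmetric ext_adj.
Proof.
suff sub a b : ext_adj a b -> ext_adj b a by move=> a b; apply/idP/idP; apply: sub.
case/orP=> [|/and3P[ra rb /andP[Kab noL]]]; rewrite /ext_adj.
  by case: a b => [x|?] [y|?] //=; rewrite adj_sym => ->.
rewrite /shortcut ra rb /missing_edge adj_sym Kab /=; apply/orP; right.
apply: contra noL => /existsP[w /existsP[w' /and3P[fw fw' Lww']]].
by apply/existsP; exists w'; apply/existsP; exists w; rewrite fw fw' adj_sym.
Qed.

Definition ext_graph : sgraph (U + V)%type := SGraph ext_adj_sym ext_adj_irr.

(** An edge of [K] is routed by its shortcut or, if it comes from [L], by the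
    Kempe chain of [G]. *)
Lemma ext_routed : routed K ext_graph ext_label ext_root.
Proof.
have [_ _ routeL] := routeG; split; [exact: ext_label_adj | exact: ext_rootK |].
move=> v v' Kvv'; case missvv': (missing_edge v v').
  apply: joined1; rewrite ?inE ?ext_rootK ?eqxx ?orbT //=.
  by rewrite /ext_adj /shortcut !ext_rootK !eqxx missvv' orbT.
move: missvv'; rewrite /missing_edge Kvv' => /negbFE.
case/existsP=> w /existsP[w' /and3P[/eqP<- /eqP<- Lww']].
rewrite !ext_rootE; apply: joined_homo (routeL _ _ Lww') => [u | x y _ _ Gxy].
  by rewrite !inE /= !(inj_eq f_inj).
by rewrite /= /ext_adj Gxy.
Qed.

(** A bag has one root, whereas a shortcut needs two: inside a bag only edges of
    [G] remain, and these never leave the copy of [G].  For an edge of [L] there is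
    no shortcut between the two bags, so they are adjacent through an edge of
    [G]. *)
Lemma certificate_restrict bag' :
    certificate K ext_graph ext_root bag' ->
  certificate L G r (fun w => [set u | inl u \in bag' (f w)]).
Proof.
case=> disj root conn edge.
have rootE v v' : ext_root v' \in bag' v -> v' = v.
  move=> v'v; apply/eqP; apply: contraTT v'v => /disj/disjointFr-> //.
have inner v a b : a \in bag' v -> b \in bag' v -> ext_adj a b ->
    exists x y, [/\ a = inl x, b = inl y & adj G x y].
  move=> va vb; case/orP=> [|/and3P[/eqP ra /eqP rb /andP[Kab _]]].
    by case: a b {va vb} => [x|?] [y|?] //= Gxy; exists x, y.
  move: va vb Kab; rewrite ra rb => /rootE + /rootE.
  by rewrite !ext_rootK => -> ->; rewrite adj_irr.
have no_inr w v : (inr v \in bag' (f w)) = false.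
  apply/negP=> wv; have fw := root (f w).
  have joinv := conn _ _ _ fw wv; move: joinv; rewrite ext_rootE.
  have inl_closed : closed [rel a b | [&& a \in bag' (f w), b \in bag' (f w)
      & ext_adj a b]] [pred a : U + V | if a is inl _ then true else false].
    by move=> a b /= /and3P[wa wb] /(inner _ _ _ wa wb)[x [y [-> ->]]].
  by move/(closed_connect inl_closed); rewrite !inE.
split.
- move=> v w vw; have fvw : f v != f w by rewrite (inj_eq f_inj).
  by apply/pred0P=> u /=; rewrite !inE; apply: (pred0P (disj _ _ fvw) (inl u)).
- by move=> w; rewrite inE -ext_rootE.
- move=> w x y; rewrite !inE => wx wy.
  pose h (a : U + V) := if a is inl u then u else r w.
  apply: (joined_homo (h := h) _ _ (conn _ _ _ wx wy)) => [[u|v] | a b wa wb Gab].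
  + by rewrite inE.
  + by rewrite no_inr.
  by have [u [v [-> ->]]] := inner _ _ _ wa wb Gab.
move=> w w' Lww'; have [a [b [wa wb]]] := edge _ _ (fL Lww').
case/orP=> [|/and3P[/eqP ra /eqP rb /andP[_]]].
  by case: a b wa wb => [x|?] [y|?] // wx wy Gxy; exists x, y; rewrite !inE.
case/existsP; exists w; apply/existsP; exists w'.
move: wa wb; rewrite {1}ra {1}rb => /rootE-> /rootE->.
by rewrite !eqxx.
Qed.

End Hereditary.

Lemma labelled_star_hom (V W : finType) (K : sgraph V) (L : sgraph W)
    (f : W -> V) :
    injective f -> (forall v w, adj L v w -> adj K (f v) (f w)) ->
  labelled_star K -> labelled_star L.
Proof.
move=> f_inj fL starK U G c r routeG.
have [bag' bagP] := starK _ _ _ _ (ext_routed K f_inj routeG).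
by exists (fun w => [set u | inl u \in bag' (f w)]); apply: certificate_restrict bagP.
Qed.

(** * Gluing the components *)

Section Local.
Variables (V : finType) (K : sgraph V) (X : {set V}).
Variables (U : finType) (G : sgraph U) (c : U -> V) (r : V -> U).
Hypotheses (starX : labelled_star (induced K X)) (routeG : routed K G c r).

(** Both ends of an edge [vw] of [K] within [X] have their classes in the
    preimage of [X], so the chain that routes [vw] lies there as well.  The bags are
    indexed by all of [V] so that the families for different [X] have the same type
    and can be merged; the last clause keeps these families apart. *)
Lemma partial_certificate :
  exists bag : V -> {set U},
  [/\ {in X &, forall v w, v != w -> [disjoint bag v & bag w]},
      {in X, forall v, r v \in bag v},
      {in X, forall v, {in bag v &, forall x y, joined G (bag v) x y}},
      {in X &, forall v w, adj K v w ->
        exists x y, [/\ x \in bag v, y \in bag w & adj G x y]}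
    & forall v u, u \in bag v -> c u \in X].
Proof.
have [Gc rK routeK] := routeG.
pose UX := c @^-1: X.
have cX (u : {u | u \in UX}) : c (val u) \in X by have := valP u; rewrite inE.
have rX (v : {v | v \in X}) : r (val v) \in UX by rewrite inE rK (valP v).
pose cs (u : {u | u \in UX}) : {v | v \in X} := Sub (c (val u)) (cX u).
pose rs (v : {v | v \in X}) : {u | u \in UX} := Sub (r (val v)) (rX v).
have route_s : routed (induced K X) (induced G UX) cs rs.
  split=> [x y /Gc | v | v w Kvw].
  - by apply: contra => /eqP/(congr1 val); rewrite !SubK => ->.
  - by apply: val_inj; rewrite !SubK rK.
  have:= routeK _ _ Kvw; have sub : c @^-1: [set val v; val w] \subset UX.
    by apply/subsetP=> u; rewrite !inE => /orP[]/eqP->; apply: valP.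
  pose h := insubd (rs v).
  have -> : rs v = h (r (val v)) by rewrite -[LHS](valKd (rs v)) SubK.
  have -> : rs w = h (r (val w)) by rewrite -[LHS](valKd (rs v)) SubK.
  apply: joined_homo => [u vwu | x y vwx vwy Gxy].
    rewrite !inE -!val_eqE !SubK /h insubdK ?(subsetP sub) //.
    by move: vwu; rewrite !inE.
  by rewrite /= /induced_adj !insubdK ?(subsetP sub).
have [bag [disj root conn edge]] := starX route_s.
pose big v : {set U} :=
  if insub v is Some v' then [set val u | u in bag v'] else set0.
have bigE v (Xv : v \in X) : big v = [set val u | u in bag (Sub v Xv)].
  by rewrite /big insubT.
exists big; split.
- move=> v w Xv Xw vw; rewrite !bigE; apply/pred0P=> u /=; apply/negP.
  case/andP=> /imsetP[x vx ->] /imsetP[y + /val_inj xy]; rewrite -{}xy.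
  by rewrite (disjointFr (disj _ _ _) vx) // -val_eqE.
- by move=> v Xv; rewrite bigE; apply/imsetP; exists (rs (Sub v Xv)).
- move=> v Xv; rewrite bigE => _ _ /imsetP[x vx ->] /imsetP[y vy ->].
  by apply: joined_homo (conn _ _ _ vx vy) => // u vu; apply: imset_f.
- move=> v w Xv Xw Kvw; rewrite !bigE.
  have [x [y [vx wy Gxy]]] := edge (Sub v Xv) (Sub w Xw) Kvw.
  by exists (val x), (val y); split=> //; apply: imset_f.
move=> v u; rewrite /big; case: insubP => [v' _ _ /imsetP[x _ ->] | _] //.
by rewrite inE.
Qed.

End Local.

Lemma labelled_star_components (V : finType) (K : sgraph V) :
    (forall X, X \in components K -> labelled_star (induced K X)) ->
  labelled_star K.
Proof.
move=> starX U G c r routeG.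
have symK : connect_sym (adj K) by apply: sym_connect_sym; apply: adj_sym.
pose comp v := [set w | connect (adj K) v w].
have compK v : comp v \in components K.
  have [X XK Xv] := component_exists K v.
  by rewrite (_ : comp v = X) //; apply/setP=> w; rewrite inE (mem_component _ XK Xv).
(* The bags of a component must come from a single choice, hence they are indexed
   by the canonical vertex [root (adj K) v] of the component of [v]. *)
have [B BP] := fin_all_exists (fun v =>
  partial_certificate (starX _ (compK v)) routeG).
pose rt := root (adj K).
have rtP v : v \in comp (rt v) by rewrite inE symK connect_root.
exists (fun v => B (rt v) v); split.
- move=> v w vw; have [rvw | rvw] := eqVneq (rt v) (rt w).
    by have [disj _ _ _ _] := BP (rt v); rewrite -rvw disj // rvw rtP.
  apply/pred0P=> u /=; apply: contraNF rvw => /andP[].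
  have [_ _ _ _ inv] := BP (rt v); have [_ _ _ _ inw] := BP (rt w).
  move=> /inv + /inw; rewrite !inE => vu wu.
  rewrite /rt -(root_root symK v) -(root_root symK w) root_connect //.
  by apply: connect_trans vu _; rewrite symK.
- by move=> v; have [_ root _ _ _] := BP (rt v); apply: root.
- by move=> v; have [_ _ conn _ _] := BP (rt v); apply: conn.
move=> v w Kvw; have rvw : rt v = rt w by apply/(rootP symK)/connect1.
have [_ _ _ edge _] := BP (rt v); rewrite -rvw.
by apply: edge => //; rewrite rvw rtP.
Qed.

Theorem theorem1 (V : finType) (K : sgraph V) :
  (property_star K ->
     forall (S : {set V}) (K' : sgraph {x : V | x \in S}),
       subgraph K' K -> property_star K') /\
  (property_star K <->
     forall C : {set V}, C \in components K -> property_star (induced K C)).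
Proof.
have hered : property_star K -> forall (S : {set V}) (K' : sgraph {x : V | x \in S}),
    subgraph K' K -> property_star K'.
  move=> /property_starE starK S K' sK'K; apply/property_starE.
  exact: labelled_star_hom val_inj sK'K starK.
split=> //; split=> [starK C _ | starC]; first exact: hered starK _ _ _.
apply/property_starE/labelled_star_components => X XK.
exact/property_starE/starC.
Qed.
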